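(* Consider the Heisenberg group $\mathbb{H}^1$ identified with $\mathbb{R}^3$ with coordinates $(x,y,z)=(x_1,x_2,x_3)$, with $$a^{\mathsf T}=\begin{pmatrix}1&0&-y/2\\0&1&x/2\end{pmatrix},\qquad z^{\mathsf T}=(0,0,1),$$ a potential $V\in C^\infty(\mathbb{R}^3)$ and $\rho^*=\frac1c e^{-V}$. Write $A_1f=\partial_xf-\frac y2\partial_zf$, $A_2f=\partial_yf+\frac x2\partial_zf$, $\mathsf Zf=\partial_zf$ and $\mathsf U=(A_1f,A_2f,\mathsf Zf)^{\mathsf T}$. Then for every $f\in C^\infty(\mathbb{H}^1)$, $$\mathfrak R_{ab}^G(\nabla f,\nabla f)+\mathfrak R_{zb}(\nabla f,\nabla f)+\mathfrak R_{\rho^*}(\nabla f,\nabla f)=\mathsf U^{\mathsf T}\mathsf A\,\mathsf U,$$ where $\mathsf A$ is the symmetric $3\times3$ matrix function with entries $$\begin{aligned}\mathsf A_{11}&=\Big[\partial_x^2V+\tfrac{y^2}{4}\partial_z^2V-y\,\partial_x\partial_zV\Big]-1,\\ \mathsf A_{22}&=\Big[\partial_y^2V+\tfrac{x^2}{4}\partial_z^2V+x\,\partial_y\partial_zV\Big]-1,\qquad \mathsf A_{33}=\tfrac12,\\ \mathsf A_{12}&=\mathsf A_{21}=\partial_x\partial_yV+\tfrac x2\partial_x\partial_zV-\tfrac y2\partial_y\partial_zV-\tfrac{xy}{4}\partial_z^2V,\\ \mathsf A_{13}&=\mathsf A_{31}=\tfrac12A_2V+\tfrac12\Big(\partial_x\partial_zV-\tfrac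 y2\partial_z^2V\Big),\\ \mathsf A_{23}&=\mathsf A_{32}=-\tfrac12A_1V+\tfrac12\Big(\partial_y\partial_zV+\tfrac x2\partial_z^2V\Big).\end{aligned}$$
   Context: General notation (here $n=2$, $m=1$). $a$ is a smooth $3\times2$ matrix function and $z$ a smooth $3\times1$ matrix function on $\mathbb{R}^3$ (the matrix $z$ is not to be confused with the coordinate $z$). Write $\partial_p=\partial/\partial x_p$, $\alpha_{ip}=(a^{\mathsf T})_{ip}$, $\zeta_p=(z^{\mathsf T})_{1p}$; indices $i,k$ run over $\{1,2\}$ and $p,q,r,s$ over $\{1,2,3\}$; a derivative acts only on the factor immediately following it. $A_if=(a^{\mathsf T}\nabla)_if=\sum_p\alpha_{ip}\partial_pf$, $\mathsf Zf=(z^{\mathsf T}\nabla)_1f=\sum_p\zeta_p\partial_pf$. $\rho^*=\frac1c e^{-V}$ with $c=\int e^{-V}dx<\infty$. Matrices and vectors: pairs $(p,q)$ are ordered lexicographically. $Q\in\mathbb{R}^{4\times9}$ has entries $Q_{(i,k),(p,q)}=\alpha_{ip}\alpha_{kq}$ (rows $(i,k)$ in lexicographic order). $P\in\mathbb{R}^{2\times9}$ has entries $P_{k,(p,q)}=\zeta_p\alpha_{kq}$. $D\in\mathbb{R}^4$: $D_{ik}=\sum_{p,r}\alpha_{ip}\,\partial_p\alpha_{kr}\,\partial_rf$. $E\in\mathbb{R}^2$: $E_i=\sum_{p,r}\alpha_{ip}\,\partial_p\zeta_r\,\partial_rf$. For the Heisenberg group, $\Lambda_1=0\in\mathbb{R}^9$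 and $\Lambda_2^{\mathsf T}=(0,0,0,0,0,0,A_2f,-A_1f,0)$. Tensors: $\mathfrak R^G_{ab}(\nabla f,\nabla f)=\mathfrak R_{ab}(\nabla f,\nabla f)-\Lambda_1^{\mathsf T}Q^{\mathsf T}Q\Lambda_1-\Lambda_2^{\mathsf T}P^{\mathsf T}P\Lambda_2+D^{\mathsf T}D+E^{\mathsf T}E$. Let $b=-\frac12aa^{\mathsf T}\nabla V$. Then $$\mathfrak R_{ab}(\nabla f,\nabla f)=\sum_{i,k}\sum_{p,q,r}\big[\alpha_{ip}\partial_p\alpha_{iq}\,\partial_q\alpha_{kr}\,\partial_rf+\alpha_{ip}\alpha_{iq}(\partial_p\partial_q\alpha_{kr})\partial_rf-\alpha_{kr}\partial_r\alpha_{ip}\,\partial_p\alpha_{iq}\,\partial_qf-\alpha_{kr}\alpha_{ip}(\partial_r\partial_p\alpha_{iq})\partial_qf\big]A_kf-2\sum_i\sum_{q,r}\big(\alpha_{iq}\partial_qb_r\,\partial_rf-b_r\partial_r\alpha_{iq}\,\partial_qf\big)A_if,$$ $$\mathfrak R_{zb}(\nabla f,\nabla f)=\sum_i\sum_{p,q,r}\big[\alpha_{ip}\partial_p\alpha_{iq}\,\partial_q\zeta_r\,\partial_rf+\alpha_{ip}\alpha_{iq}(\partial_p\partial_q\zeta_r)\partial_rf-\zeta_r\partial_r\alpha_{ip}\,\partial_p\alpha_{iq}\,\partial_qf-\zeta_r\alpha_{ip}(\partial_r\partial_p\alpha_{iq})\partial_qf\big]\mathsf Zf-2\sum_{q,r}\big(\zeta_q\partial_qb_r\,\partial_rf-b_r\partial_r\zeta_q\,\partial_qf\big)\mathsf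 Zf,$$ $$\begin{aligned}\mathfrak R_{\rho^*}(\nabla f,\nabla f)=&\ 2\sum_i\sum_{p,q,r,s}\big[(\partial_p\zeta_p)\zeta_q(\partial_q\alpha_{ir})\alpha_{is}+\zeta_p(\partial_p\zeta_q)(\partial_q\alpha_{ir})\alpha_{is}+\zeta_p\zeta_q(\partial_p\partial_q\alpha_{ir})\alpha_{is}+\zeta_p\zeta_q(\partial_q\alpha_{ir})(\partial_p\alpha_{is})\big]\partial_rf\,\partial_sf\\&+2\sum_i\sum_{q,r,s}(\mathsf Z\log\rho^* )\zeta_q(\partial_q\alpha_{ir})\alpha_{is}\,\partial_rf\,\partial_sf\\&-2\sum_i\sum_{p,q,r,s}\big[(\partial_p\alpha_{ip})\alpha_{iq}(\partial_q\zeta_r)\zeta_s+\alpha_{ip}(\partial_p\alpha_{iq})(\partial_q\zeta_r)\zeta_s+\alpha_{ip}\alpha_{iq}(\partial_p\partial_q\zeta_r)\zeta_s+\alpha_{ip}\alpha_{iq}(\partial_q\zeta_r)(\partial_p\zeta_s)\big]\partial_rf\,\partial_sf\\&-2\sum_i\sum_{q,r,s}(A_i\log\rho^* )\alpha_{iq}(\partial_q\zeta_r)\zeta_s\,\partial_rf\,\partial_sf.\end{aligned}$$ *)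

(* Defs.v *)
From mathcomp Require Import all_boot all_order all_algebra.
From mathcomp Require Import all_classical all_reals all_analysis.
From mathcomp Require Import mxtens.

Set Implicit Arguments.
Unset Strict Implicit.
Unset Printing Implicit Defensive.

Import Order.TTheory GRing.Theory Num.Theory.
Import numFieldNormedType.Exports.

Local Open Scope ring_scope.

(* Points of R^3 are row vectors x : 'rV[R]_3, and (x_1, x_2, x_3) is
   (x 0 0, x 0 1, x 0 2): all indices are shifted down by one. *)

Section Calculus.
Context {R : realType}.
Implicit Types (f : 'rV[R]_3 -> R) (p : 'I_3).

Definition partial p f : 'rV[R]_3 -> R := 'D_(delta_mx 0 p) f.

Definition partials (s : seq 'I_3) f : 'rV[R]_3 -> R := foldr partial f s.

(* f is C^oo: its partial derivatives of all orders exist everywhere and are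
   continuous. *)
Definition smooth f : Prop :=
  forall s : seq 'I_3,
    continuous (partials s f) /\
    forall p x, derivable (partials s f) x (delta_mx 0 p).

Definition seqmx m n (rows : seq (seq R)) : 'M[R]_(m, n) :=
  \matrix_(i, j) (nth [::] rows i)`_j.

End Calculus.

Section ReferenceDensity.
Context {R : realType}.
Implicit Types V : 'rV[R]_3 -> R.

(* Lebesgue measure on R^3, carried by R * R * R. *)
Definition lebesgue3 :
    {measure set (measurableTypeR R * measurableTypeR R * measurableTypeR R)
       -> \bar R} :=
  ((@lebesgue_measure R \x @lebesgue_measure R) \x @lebesgue_measure R)%E.

Definition point3 (u : R * R * R) : 'rV[R]_3 :=
  seqmx 1 3 [:: [:: u.1.1; u.1.2; u.2]].

(* The constant c, before it is known to be finite. *)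
Definition partition_function V : \bar R :=
  (\int[lebesgue3]_u (expR (- V (point3 u)))%:E)%E.

Definition rho_star V : 'rV[R]_3 -> R :=
  fun x => (fine (partition_function V))^-1 * expR (- V x).

End ReferenceDensity.

Section Tensors.
Context {R : realType}.
Variables (a : 'rV[R]_3 -> 'M[R]_(3, 2)) (z : 'rV[R]_3 -> 'M[R]_(3, 1)).
Implicit Types (V f : 'rV[R]_3 -> R) (x : 'rV[R]_3).

Let alpha (i : 'I_2) (p : 'I_3) : 'rV[R]_3 -> R := fun x => (a x)^T i p.
Let zeta (p : 'I_3) : 'rV[R]_3 -> R := fun x => (z x)^T 0 p.

Definition Aop (i : 'I_2) f : 'rV[R]_3 -> R :=
  fun x => \sum_p alpha i p x * partial p f x.

Definition Zop f : 'rV[R]_3 -> R :=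
  fun x => \sum_p zeta p x * partial p f x.

(* mxtens_unindex decodes the position of a pair in lexicographic order. *)
Definition Qmx x : 'M[R]_(2 * 2, 3 * 3) :=
  \matrix_(u, v) let: (i, k) := mxtens_unindex u in
                 let: (p, q) := mxtens_unindex v in
                 alpha i p x * alpha k q x.

Definition Pmx x : 'M[R]_(2, 3 * 3) :=
  \matrix_(k, v) let: (p, q) := mxtens_unindex v in
                 zeta p x * alpha k q x.

Definition Dvec f x : 'cV[R]_(2 * 2) :=
  \col_u let: (i, k) := mxtens_unindex u in
         \sum_p \sum_r alpha i p x * partial p (alpha k r) x * partial r f x.

Definition Evec f x : 'cV[R]_2 :=
  \col_i \sum_p \sum_r alpha i p x * partial p (zeta r) x * partial r f x.

Definition drift V (r : 'I_3) : 'rV[R]_3 -> R :=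
  fun x => (- 2^-1 *: (a x *m (a x)^T *m \col_p partial p V x)) r 0.

Definition Rab V f x : R :=
  let b := drift V in
  \sum_i \sum_k
    (\sum_p \sum_q \sum_r
       (alpha i p x * partial p (alpha i q) x * partial q (alpha k r) x
          * partial r f x
        + alpha i p x * alpha i q x * partial p (partial q (alpha k r)) x
          * partial r f x
        - alpha k r x * partial r (alpha i p) x * partial p (alpha i q) x
          * partial q f x
        - alpha k r x * alpha i p x * partial r (partial p (alpha i q)) x
          * partial q f x))
    * Aop k f x
  - 2 * \sum_i
      (\sum_q \sum_r
         (alpha i q x * partial q (b r) x * partial r f x
          - b r x * partial r (alpha i q) x * partial q f x))
      * Aop i f x.

Definition Rzb V f x : R :=
  let b := drift V in
  \sum_i
    (\sum_p \sum_q \sum_r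
       (alpha i p x * partial p (alpha i q) x * partial q (zeta r) x
          * partial r f x
        + alpha i p x * alpha i q x * partial p (partial q (zeta r)) x
          * partial r f x
        - zeta r x * partial r (alpha i p) x * partial p (alpha i q) x
          * partial q f x
        - zeta r x * alpha i p x * partial r (partial p (alpha i q)) x
          * partial q f x))
    * Zop f x
  - 2 * (\sum_q \sum_r
           (zeta q x * partial q (b r) x * partial r f x
            - b r x * partial r (zeta q) x * partial q f x))
      * Zop f x.

Definition Rrho V f x : R :=
  let log_rho : 'rV[R]_3 -> R := fun y => ln (rho_star V y) in
  2 * (\sum_i \sum_p \sum_q \sum_r \sum_s
         (partial p (zeta p) x * zeta q x * partial q (alpha i r) x
            * alpha i s x
          + zeta p x * partial p (zeta q) x * partial q (alpha i r) x
            * alpha i s x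
          + zeta p x * zeta q x * partial p (partial q (alpha i r)) x
            * alpha i s x
          + zeta p x * zeta q x * partial q (alpha i r) x
            * partial p (alpha i s) x)
         * partial r f x * partial s f x)
  + 2 * (\sum_i \sum_q \sum_r \sum_s
           Zop log_rho x * zeta q x * partial q (alpha i r) x * alpha i s x
           * partial r f x * partial s f x)
  - 2 * (\sum_i \sum_p \sum_q \sum_r \sum_s
           (partial p (alpha i p) x * alpha i q x * partial q (zeta r) x
              * zeta s x
            + alpha i p x * partial p (alpha i q) x * partial q (zeta r) x
              * zeta s x
            + alpha i p x * alpha i q x * partial p (partial q (zeta r)) x
              * zeta s x
            + alpha i p x * alpha i q x * partial q (zeta r) x
              * partial p (zeta s) x)
           * partial r f x * partial s f x)
  - 2 * (\sum_i \sum_q \sum_r \sum_s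
           Aop i log_rho x * alpha i q x * partial q (zeta r) x * zeta s x
           * partial r f x * partial s f x).

Definition RGab (Lambda1 Lambda2 : 'rV[R]_3 -> 'cV[R]_(3 * 3)) V f x : R :=
  Rab V f x
  - ((Lambda1 x)^T *m (Qmx x)^T *m Qmx x *m Lambda1 x) 0 0
  - ((Lambda2 x)^T *m (Pmx x)^T *m Pmx x *m Lambda2 x) 0 0
  + ((Dvec f x)^T *m Dvec f x) 0 0
  + ((Evec f x)^T *m Evec f x) 0 0.

End Tensors.

Section Heisenberg.
Context {R : realType}.
Implicit Types (V f : 'rV[R]_3 -> R) (x : 'rV[R]_3).

Definition heis_a x : 'M[R]_(3, 2) :=
  (seqmx 2 3 [:: [:: 1; 0; - (x 0 1 / 2)];
                 [:: 0; 1; x 0 0 / 2]])^T.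

Definition heis_z x : 'M[R]_(3, 1) := (seqmx 1 3 [:: [:: 0; 0; 1]])^T.

Definition heis_A1 : ('rV[R]_3 -> R) -> 'rV[R]_3 -> R := Aop heis_a 0.
Definition heis_A2 : ('rV[R]_3 -> R) -> 'rV[R]_3 -> R := Aop heis_a 1.
Definition heis_Z : ('rV[R]_3 -> R) -> 'rV[R]_3 -> R := Zop heis_z.

Definition heis_Lambda1 x : 'cV[R]_(3 * 3) := 0.

Definition heis_Lambda2 f x : 'cV[R]_(3 * 3) :=
  (seqmx 1 (3 * 3)
     [:: [:: 0; 0; 0; 0; 0; 0; heis_A2 f x; - heis_A1 f x; 0]])^T.

Definition heis_U f x : 'cV[R]_3 :=
  (seqmx 1 3 [:: [:: heis_A1 f x; heis_A2 f x; heis_Z f x]])^T.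

Definition heis_mx V x : 'M[R]_3 :=
  let x1 := x 0 0 in let x2 := x 0 1 in
  let d2 p q := partial p (partial q V) x in
  let A11 := (d2 0 0 + x2 ^+ 2 / 4 * d2 2 2 - x2 * d2 0 2) - 1 in
  let A22 := (d2 1 1 + x1 ^+ 2 / 4 * d2 2 2 + x1 * d2 1 2) - 1 in
  let A33 := 2^-1 in
  let A12 := d2 0 1 + x1 / 2 * d2 0 2 - x2 / 2 * d2 1 2
             - x1 * x2 / 4 * d2 2 2 in
  let A13 := 2^-1 * heis_A2 V x + 2^-1 * (d2 0 2 - x2 / 2 * d2 2 2) in
  let A23 := - (2^-1 * heis_A1 V x) + 2^-1 * (d2 1 2 + x1 / 2 * d2 2 2) in
  seqmx 3 3 [:: [:: A11; A12; A13];
                [:: A12; A22; A23];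
                [:: A13; A23; A33]].

End Heisenberg.

(* Main.v *)
Require Import Defs.
From mathcomp Require Import all_boot all_order all_algebra.
From mathcomp Require Import all_classical all_reals all_analysis.
From mathcomp Require Import mxtens ring lra.

Import Order.TTheory GRing.Theory Num.Theory.
Import numFieldNormedType.Exports.

Local Open Scope ring_scope.

(** On the Heisenberg group the fields A_i have affine coefficients whose only
    nonzero derivatives are d_y alpha_13 = -1/2 and d_x alpha_23 = 1/2, and Z has
    constant coefficients.  Hence d_p alpha_iq * d_q alpha_kr = 0 and
    zeta_q * d_q alpha_ir = 0, which kills every second-order term of R_ab and
    R_zb and all of R_rho*.  What survives are the derivatives of the drift, given by the
    product rule, and the squares |D|^2 = (Zf)^2 / 2 and
    |P Lambda_2|^2 = (A_1 f)^2 + (A_2 f)^2.  The Hessian of V enters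
    symmetrized, hence the need for Schwarz's theorem, obtained from the mean
    value theorem applied twice to the second difference of V. *)

(** * Schwarz's theorem for directional derivatives *)

Section MixedDerivatives.
Context {R : realType} {W : normedModType R}.
Implicit Types (f : W -> R) (u v x : W).

(** The difference quotients of the restriction to the line and of [f] along [u] are the same
    function of the increment, so derivability and value transfer without a chain rule. *)
Lemma is_derive_line f x u (t : R) : derivable f (x + t *: u) u ->
  is_derive t 1 (fun s : R => f (x + s *: u)) ('D_u f (x + t *: u)).
Proof.
have E : (fun h : R => h^-1 *: (((fun s : R => f (x + s *: u)) \o shift t) (h *: 1)
              - f (x + t *: u)))
  = (fun h : R => h^-1 *: ((f \o shift (x + t *: u)) (h *: u) - f (x + t *: u))).
  by apply/funext => h /=; rewrite [h *: 1]mulr1 scalerDl addrCA.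
move=> fu; split; first by rewrite /derivable E.
by rewrite /derive E.
Qed.

Lemma MVT_line f x u (h : R) : 0 <= h -> (forall y, derivable f y u) ->
  exists2 t, t \in `[0, h] & f (x + h *: u) - f x = 'D_u f (x + t *: u) * h.
Proof.
move=> h0 fu.
have df (t : R) := is_derive_line _ _ _ _ (fu (x + t *: u)).
have [t th] : exists2 t, t \in `[0, h] &
    f (x + h *: u) - f (x + 0 *: u) = 'D_u f (x + t *: u) * (h - 0).
  apply: (@MVT_segment _ (fun s : R => f (x + s *: u))) => //.
  by apply: derivable_within_continuous => t _; apply: ex_derive.
by rewrite scale0r addr0 subr0 => E; exists t.
Qed.

(** The second difference is the increment along [u] of y |-> f(y + hv) - f(y). The mean value
    theorem along [u] turns it into an increment of ['D_u f] along [v], to which the theorem applies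
    again. *)
Lemma MVT_second_difference f x u v (h : R) : 0 <= h ->
  (forall y, derivable f y u) -> (forall y, derivable ('D_u f) y v) ->
  exists s t, [/\ s \in `[0, h], t \in `[0, h] &
    f (x + h *: u + h *: v) - f (x + h *: u) - f (x + h *: v) + f x
    = 'D_v ('D_u f) (x + s *: u + t *: v) * h ^+ 2].
Proof.
move=> h0 fu fuv.
pose g y := f (y + h *: v) - f y.
have fvu y : is_derive y u (fun z => f (z + h *: v)) ('D_u f (y + h *: v)).
  have E : (fun k : R => k^-1 *: (((fun z => f (z + h *: v)) \o shift y) (k *: u)
              - f (y + h *: v)))
    = (fun k : R => k^-1 *: ((f \o shift (y + h *: v)) (k *: u) - f (y + h *: v))).
    by apply/funext => k /=; rewrite addrA.
  split; first by rewrite /derivable E; apply: fu.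
  by rewrite /derive E.
have gu y : is_derive y u g ('D_u f (y + h *: v) - 'D_u f y).
  by apply: is_deriveB => //; apply: derivableP.
have [s sh Es] : exists2 s, s \in `[0, h] &
    g (x + h *: u) - g x = 'D_u g (x + s *: u) * h.
  by apply: (MVT_line g x u h h0) => y; have [] := gu y.
have [t th Et] := MVT_line ('D_u f) (x + s *: u) v h h0 fuv.
exists s, t; split => //.
rewrite expr2 mulrA -Et -(@derive_val _ _ _ _ _ _ _ (gu (x + s *: u))) -Es /g.
by rewrite opprB addrA addrAC.
Qed.

(** Both points where the values agree tend to [x] as [h] tends to 0, so continuity at [x] suffices.
    [u] and [v] are swapped on the side of [G] because the second difference is expanded once in
    each order. *)
Lemma eq_from_close_values (F G : W -> R) u v x :
  {for x, continuous F} -> {for x, continuous G} ->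
  (forall h : R, 0 < h -> exists s1 t1 s2 t2,
     [/\ s1 \in `[0, h], t1 \in `[0, h], s2 \in `[0, h], t2 \in `[0, h] &
       F (x + s1 *: u + t1 *: v) = G (x + s2 *: v + t2 *: u)]) ->
  F x = G x.
Proof.
move=> cF cG FG.
apply/eqP; rewrite -subr_eq0 -normr_le0; apply/ler_addgt0Pl => e e0.
rewrite addr0.
have e20 : 0 < e / 2 by rewrite divr_gt0.
have /cvgrPdist_lt/(_ _ e20)/nbhs_ballP[r1 /= r10 Hr1] := cF.
have /cvgrPdist_lt/(_ _ e20)/nbhs_ballP[r2 /= r20 Hr2] := cG.
pose r := Num.min r1 r2.
have r0 : 0 < r by rewrite lt_min r10.
(* The summand 1 keeps [n] positive even when [u] and [v] both vanish; [h] is chosen so that h n =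
   r/2 < r. *)
pose n := `|u| + `|v| + 1.
have n0 : 0 < n by rewrite ltr_wpDl// addr_ge0.
pose h := r / 2 / n.
have h0 : 0 < h by rewrite !divr_gt0.
have close a b s t : `|a| + `|b| <= n -> s \in `[0, h] -> t \in `[0, h] ->
    ball x r (x + s *: a + t *: b).
  rewrite !in_itv/= => abn /andP[s0 sh] /andP[t0 th].
  rewrite -ball_normE /= -addrA opprD addNKr normrN.
  rewrite (le_lt_trans (ler_normD _ _))// !normrZ (ger0_norm s0) (ger0_norm t0).
  apply: (@le_lt_trans _ _ (h * n)); last by rewrite /h divfK ?gt_eqF//; lra.
  apply: le_trans (ler_wpM2l (ltW h0) abn).
  by rewrite mulrDr lerD// ler_wpM2r.
have nuv : `|u| + `|v| <= n by rewrite /n; lra.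
have nvu : `|v| + `|u| <= n by rewrite /n; lra.
have [s1 [t1 [s2 [t2 [s1h t1h s2h t2h E]]]]] := FG h h0.
have /Hr1 B1 : ball x r1 (x + s1 *: u + t1 *: v).
  by apply: (@le_ball _ _ x r); [rewrite ge_min lexx | apply: close].
have /Hr2 B2 : ball x r2 (x + s2 *: v + t2 *: u).
  by apply: (@le_ball _ _ x r); [rewrite ge_min lexx orbT | apply: close].
rewrite [e]splitr (le_trans (ler_distD (F (x + s1 *: u + t1 *: v)) _ _))//.
by apply: lerD; rewrite ltW// E distrC.
Qed.

(** The second difference of [f] is symmetric in [u] and [v]; expanding it in both orders and
    dividing by h^2 equates the two mixed derivatives at points close to [x]. *)
Lemma derive_comm f u v x :
  (forall y, derivable f y u) -> (forall y, derivable f y v) ->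
  (forall y, derivable ('D_u f) y v) -> (forall y, derivable ('D_v f) y u) ->
  {for x, continuous ('D_v ('D_u f))} -> {for x, continuous ('D_u ('D_v f))} ->
  'D_u ('D_v f) x = 'D_v ('D_u f) x.
Proof.
move=> fu fv fuv fvu cuv cvu; apply/esym.
apply: (eq_from_close_values _ _ u v x cuv cvu) => h h0.
have [s1 [t1 [s1h t1h E1]]] := MVT_second_difference f x u v h (ltW h0) fu fuv.
have [s2 [t2 [s2h t2h E2]]] := MVT_second_difference f x v u h (ltW h0) fv fvu.
exists s1, t1, s2, t2; split; [exact: s1h|exact: t1h|exact: s2h|exact: t2h|].
apply: (@mulIf _ (h ^+ 2)); first by rewrite expf_neq0 ?gt_eqF.
apply: etrans (esym E1) (etrans _ E2).
rewrite (addrAC x (h *: v)); congr (_ + _); exact: addrAC.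
Qed.

End MixedDerivatives.

Lemma partialC (R : realType) (f : 'rV[R]_3 -> R) p q x : smooth f ->
  partial p (partial q f) x = partial q (partial p f) x.
Proof.
move=> sf; apply: derive_comm.
- exact: (sf [::]).2.
- exact: (sf [::]).2.
- exact: (sf [:: p]).2.
- exact: (sf [:: q]).2.
- exact: (sf [:: q; p]).1.
- exact: (sf [:: p; q]).1.
Qed.

(** * Small index sets, lexicographic pairs and squared norms *)

Lemma ord3P (p : 'I_3) : [\/ p = 0, p = 1 | p = 2].
Proof.
by case: p => -[|[|[|//]]] ?; [apply: Or31|apply: Or32|apply: Or33]; exact/val_inj.
Qed.

Lemma ord2P (i : 'I_2) : i = 0 \/ i = 1.
Proof. by case: i => -[|[|//]] ?; [left|right]; exact/val_inj. Qed.

Lemma sum_ord3 (R : nmodType) (F : 'I_3 -> R) : \sum_i F i = F 0 + F 1 + F 2.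
Proof.
by rewrite !big_ord_recl big_ord0 addr0 addrA; congr (_ + F _ + F _); exact/val_inj.
Qed.

Lemma sum_ord2 (R : nmodType) (F : 'I_2 -> R) : \sum_i F i = F 0 + F 1.
Proof.
by rewrite !big_ord_recl big_ord0 addr0; congr (_ + F _); exact/val_inj.
Qed.

Lemma sum_mxtens_index (M : nmodType) m n (F : 'I_(m * n) -> M) :
  \sum_u F u = \sum_i \sum_j F (mxtens_index (i, j)).
Proof.
rewrite (reindex (@mxtens_index m n)) /=; last first.
  by exists (@mxtens_unindex m n) => u _; [exact: mxtens_indexK|exact: mxtens_unindexK].
by rewrite pair_big /=; apply: eq_bigr => -[].
Qed.

Lemma sqnorm_mx (R : comPzRingType) n (u : 'cV[R]_n) :
  (u^T *m u) 0 0 = \sum_i u i 0 ^+ 2.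
Proof. by rewrite mxE; apply: eq_bigr => i _; rewrite mxE. Qed.

(** * The Heisenberg frame and its constant derivatives *)

Section HeisenbergFrame.
Context {R : realType}.
Implicit Types (V f : 'rV[R]_3 -> R) (x : 'rV[R]_3) (i k : 'I_2) (p q r : 'I_3).

(** The coefficient alpha_iq, named so that rewriting can target it. *)
Definition frame i q : 'rV[R]_3 -> R := fun x => (heis_a x)^T i q.

Lemma frame00 x : frame 0 0 x = 1. Proof. by rewrite /frame !mxE. Qed.
Lemma frame01 x : frame 0 1 x = 0. Proof. by rewrite /frame !mxE. Qed.
Lemma frame02 x : frame 0 2 x = - (x 0 1 / 2). Proof. by rewrite /frame !mxE. Qed.
Lemma frame10 x : frame 1 0 x = 0. Proof. by rewrite /frame !mxE. Qed.
Lemma frame11 x : frame 1 1 x = 1. Proof. by rewrite /frame !mxE. Qed.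
Lemma frame12 x : frame 1 2 x = x 0 0 / 2. Proof. by rewrite /frame !mxE. Qed.
Definition frameE := (frame00, frame01, frame02, frame10, frame11, frame12).

(** The derivative d_p alpha_iq, a number rather than a function since the frame is affine. *)
Definition dframe p i q : R :=
  if q == 2 then
    (if i == 0 then - ((p == 1)%:R / 2) else (p == 0)%:R / 2)
  else 0.

Lemma is_derive_coord x v q : is_derive x v (fun y : 'rV[R]_3 => y 0 q) (v 0 q).
Proof.
split; first by have /derivable_mxP/(_ 0 q) := @derivable_id _ _ x v.
have := derive_mx (@derivable_id _ _ x v).
by rewrite derive_id => /matrixP/(_ 0 q); rewrite mxE => ->.
Qed.

Lemma is_derive_frame p i q x :
  is_derive x (delta_mx 0 p) (frame i q) (dframe p i q).
Proof.
have cD := is_derive_coord x (delta_mx 0 p).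
have cst_frame c : (forall y, frame i q y = c) ->
    is_derive x (delta_mx 0 p) (frame i q) 0.
  by move=> h; rewrite (_ : frame i q = cst c); [exact: is_derive_cst|exact/funext].
case: (ord2P i) cst_frame => ->; case: (ord3P q) => -> H; rewrite /dframe /=.
- exact: H frame00.
- exact: H frame01.
- rewrite (_ : frame _ _ = - (2^-1 *: (fun y : 'rV[R]_3 => y 0 1))); last first.
    by apply/funext => y; rewrite frameE mulrC.
  apply: is_derive_eq.
  by rewrite !mxE eqxx /= eq_sym mulrC.
- exact: H frame10.
- exact: H frame11.
- rewrite (_ : frame _ _ = (2^-1 *: (fun y : 'rV[R]_3 => y 0 0))); last first.
    by apply/funext => y; rewrite frameE mulrC.
  apply: is_derive_eq.
  by rewrite !mxE eqxx /= eq_sym mulrC.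
Qed.

Lemma partial_frame p i q : partial p (frame i q) = cst (dframe p i q).
Proof.
by apply/funext => x; rewrite /partial; have [_ ->] := is_derive_frame p i q x.
Qed.

Lemma partial_cst p (c : R) : partial p (cst c) = cst 0.
Proof. by apply/funext => x; exact: derive_cst. Qed.

(** The coefficient zeta_p of the central field [heis_Z]. *)
Definition center p : 'rV[R]_3 -> R := fun x => (heis_z x)^T 0 p.

Lemma centerE p : center p = cst (p == 2)%:R.
Proof.
by apply/funext => x; rewrite /center !mxE; case: (ord3P p) => ->.
Qed.

Lemma dframe_vertical i q : dframe 2 i q = 0.
Proof. by rewrite /dframe (_ : 2 == 0 = false)// !mul0r oppr0 !if_same. Qed.

Lemma dframe_center i q r : (q == 2)%:R * dframe q i r = 0.
Proof. by case: (q =P 2) => [->|_]; rewrite ?mul0r// dframe_vertical mulr0. Qed.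

(** Only the vertical coefficients ([q = 2]) vary, and no coefficient depends on the vertical
    coordinate. *)
Lemma dframe_dframe p i q r k : dframe p i q * dframe q k r = 0.
Proof.
have [->|q2] := eqVneq q 2; first by rewrite dframe_vertical mulr0.
by rewrite {1}/dframe (negbTE q2) mul0r.
Qed.

(** * Derivatives of the horizontal fields applied to V, and of the drift *)

(** The derivative d_p (A_i V), expanded by the product rule. *)
Definition dhoriz p i V x : R :=
  \sum_q (dframe p i q * partial q V x + frame i q x * partial p (partial q V) x).

Lemma is_derive_horiz p i V x : smooth V ->
  is_derive x (delta_mx 0 p) (Aop heis_a i V) (dhoriz p i V x).
Proof.
move=> sV.
rewrite (_ : Aop _ _ _ = \sum_q (frame i q * partial q V)); last first.
  by apply/funext => y; rewrite /Aop fct_sumE.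
apply: is_derive_sum => q.
have dV : is_derive x (delta_mx 0 p) (partial q V) (partial p (partial q V) x).
  by apply: derivableP; exact: (sV [:: q]).2.
have dF := is_derive_frame p i q x.
apply: is_derive_eq.
by rewrite addrC /GRing.scale /= (mulrC (partial q V x)).
Qed.

(** Since (a^T grad V)_i = A_i V, the drift is -1/2 times the horizontal gradient of V, a form ready
    for the product rule. *)
Lemma driftE r V x :
  drift heis_a V r x = - 2^-1 * \sum_i frame i r x * Aop heis_a i V x.
Proof.
rewrite /drift mxE -mulmxA mxE; congr (_ * _).
apply: eq_bigr => i _; rewrite /frame [in RHS]mxE; congr (_ * _).
by rewrite mxE /Aop; apply: eq_bigr => q _; rewrite [X in _ * X = _]mxE.
Qed.

Lemma partial_drift p r V x : smooth V ->
  partial p (drift heis_a V r) x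
  = - 2^-1 * \sum_i (dframe p i r * Aop heis_a i V x + frame i r x * dhoriz p i V x).
Proof.
move=> sV.
rewrite (_ : drift _ _ _ = - 2^-1 *: \sum_i (frame i r * Aop heis_a i V)); last first.
  by apply/funext => y; rewrite driftE fctE fct_sumE.
have dA i := is_derive_horiz p i V x sV.
have dF i := is_derive_frame p i r x.
have D : is_derive x (delta_mx 0 p) (\sum_i (frame i r * Aop heis_a i V))
   (\sum_i (dframe p i r * Aop heis_a i V x + frame i r x * dhoriz p i V x)).
  apply: is_derive_sum => i; apply: is_derive_eq.
  by rewrite addrC /GRing.scale /= (mulrC (Aop _ _ _ x)).
by rewrite /partial; have [_ ->] := is_deriveZ (- 2^-1) D.
Qed.

(** * Vanishing terms in the three curvature tensors *)

Lemma partial_center p q : partial p (center q) = cst 0.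
Proof. by rewrite centerE partial_cst. Qed.

(** Every summand of the first two sums contains a derivative of zeta, a second derivative of alpha,
    or zeta_q d_q alpha_ir; every summand of the last two contains a derivative of zeta. All these
    factors are zero. *)
Lemma Rrho_heis V f x : Rrho heis_a heis_z V f x = 0.
Proof.
have fr i q : (fun y => (heis_a y)^T i q) = frame i q by [].
have ce q : (fun y => (heis_z y)^T 0 q) = center q by [].
have ze q : (heis_z x)^T 0 q = (q == 2)%:R by rewrite -[LHS]/(center q x) centerE.
rewrite /Rrho.
rewrite [X in _ * X + _ - _ - _]big1 => [|i _]; last first.
  rewrite big1// => p _; rewrite big1// => q _; rewrite big1// => r _.
  rewrite big1// => s _; rewrite !ce !fr !partial_center !partial_frame !partial_cst /=.
  rewrite !ze !(mulr0, mul0r, add0r) -(mulrA _ _ (dframe q i r)) dframe_center.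
  by rewrite !(mulr0, mul0r).
rewrite [X in _ + _ * X - _ - _]big1 => [|i _]; last first.
  rewrite big1// => q _; rewrite big1// => r _; rewrite big1// => s _.
  rewrite !fr !partial_frame ze -(mulrA _ _ (dframe q i r)) dframe_center.
  by rewrite !(mulr0, mul0r).
rewrite [X in _ - _ * X - _]big1 => [|i _]; last first.
  rewrite big1// => p _; rewrite big1// => q _; rewrite big1// => r _.
  rewrite big1// => s _.
  by rewrite !ce !partial_center !partial_cst /= !(mulr0, mul0r, addr0).
rewrite [X in _ - _ * X = _]big1 => [|i _]; last first.
  rewrite big1// => q _; rewrite big1// => r _; rewrite big1// => s _.
  by rewrite !ce !partial_center /= !(mulr0, mul0r).
by rewrite !mulr0 !subr0 addr0.
Qed.

Lemma ZopE f x : heis_Z f x = partial 2 f x.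
Proof.
transitivity (\sum_q center q x * partial q f x) => //.
by rewrite sum_ord3 !centerE /= !mul0r !add0r mul1r.
Qed.

Lemma Rzb_heis V f x :
  Rzb heis_a heis_z V f x =
  - 2 * (\sum_r partial 2 (drift heis_a V r) x * partial r f x) * partial 2 f x.
Proof.
have fr i q : (fun y => (heis_a y)^T i q) = frame i q by [].
have ce q : (fun y => (heis_z y)^T 0 q) = center q by [].
have ze q : (heis_z x)^T 0 q = (q == 2)%:R by rewrite -[LHS]/(center q x) centerE.
rewrite /Rzb -/(heis_Z f x) ZopE big1 => [|i _]; last first.
  rewrite big1 ?mul0r// => p _; rewrite big1// => q _; rewrite big1// => r _.
  rewrite !ce !fr !partial_center !partial_frame !partial_cst /=.
  by rewrite !ze dframe_center !(mulr0, mul0r, addr0, subr0).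
rewrite sub0r -!mulNr; congr (_ * _ * _).
rewrite sum_ord3 !ze /= [X in X + _ + _]big1 => [|r _]; last first.
  by rewrite partial_cst /= !(mulr0, mul0r, subr0).
rewrite [X in _ + X + _]big1 => [|r _]; last first.
  by rewrite partial_cst /= !(mulr0, mul0r, subr0).
rewrite !add0r; apply: eq_bigr => r _.
by rewrite partial_cst /= mulr0 mul0r subr0 mul1r.
Qed.

(** The four second-order terms contain either a product killed by [dframe_dframe] or a second
    derivative of an affine coefficient; only the drift part remains. *)
Lemma Rab_heis_sum V f x :
  Rab heis_a V f x =
  - 2 * \sum_i (\sum_q \sum_r
      (frame i q x * partial q (drift heis_a V r) x * partial r f x
       - drift heis_a V r x * dframe r i q * partial q f x)) * Aop heis_a i f x.
Proof.
have fr i q : (fun y => (heis_a y)^T i q) = frame i q by [].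
rewrite /Rab big1 => [|i _]; last first.
  rewrite big1// => k _; rewrite big1 ?mul0r// => p _; rewrite big1// => q _.
  rewrite big1// => r _.
  rewrite !fr !partial_frame !partial_cst /=.
  rewrite -(mulrA _ (dframe p i q)) dframe_dframe.
  rewrite -(mulrA _ (dframe r i p)) dframe_dframe.
  by rewrite !(mulr0, mul0r, addr0, subr0).
rewrite sub0r mulNr; congr (- (_ * _)); apply: eq_bigr => i _; congr (_ * _).
apply: eq_bigr => q _; apply: eq_bigr => r _.
by rewrite !fr partial_frame.
Qed.

Lemma AopE0 f x : Aop heis_a 0 f x = partial 0 f x - x 0 1 / 2 * partial 2 f x.
Proof.
transitivity (\sum_q frame 0 q x * partial q f x) => //.
by rewrite sum_ord3 !frameE mul1r mul0r addr0 mulNr.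
Qed.

Lemma AopE1 f x : Aop heis_a 1 f x = partial 1 f x + x 0 0 / 2 * partial 2 f x.
Proof.
transitivity (\sum_q frame 1 q x * partial q f x) => //.
by rewrite sum_ord3 !frameE mul1r mul0r add0r.
Qed.

(** * The squared norms in the generalized tensor *)

(** The only nonzero entries are D_12 = Zf/2 and D_21 = -Zf/2. This is the source of A_33 = 1/2. *)
Lemma sqnorm_Dvec f x :
  ((Dvec heis_a f x)^T *m Dvec heis_a f x) 0 0 = 2^-1 * partial 2 f x ^+ 2.
Proof.
have E i k : Dvec heis_a f x (mxtens_index (i, k)) 0
    = \sum_p \sum_r frame i p x * dframe p k r * partial r f x.
  rewrite mxE mxtens_indexK; apply: eq_bigr => p _; apply: eq_bigr => r _.
  by rewrite -[fun y => (heis_a y)^T k r]/(frame k r) partial_frame.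
rewrite sqnorm_mx sum_mxtens_index !sum_ord2 !E !sum_ord3 /dframe /= !frameE.
move: (partial 2 f x) (x 0 0) (x 0 1) => f2 x1 x2.
by field.
Qed.

Lemma sqnorm_Evec f x :
  ((Evec heis_a heis_z f x)^T *m Evec heis_a heis_z f x) 0 0 = 0.
Proof.
rewrite sqnorm_mx big1// => i _; rewrite mxE big1 ?expr0n// => p _.
rewrite big1// => r _.
by rewrite -[fun y => (heis_z y)^T 0 r]/(center r) partial_center mulr0 mul0r.
Qed.

(** As zeta = (0,0,1), [Pmx] only sees the last three entries of Lambda_2, and P Lambda_2 = (A_2 f,
    -A_1 f). This is the source of the -1 in A_11 and A_22. *)
Lemma sqnorm_P_Lambda2 f x :
  ((heis_Lambda2 f x)^T *m (Pmx heis_a heis_z x)^T *m Pmx heis_a heis_z x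
     *m heis_Lambda2 f x) 0 0
  = heis_A1 f x ^+ 2 + heis_A2 f x ^+ 2.
Proof.
rewrite -trmx_mul -mulmxA sqnorm_mx.
have E k : (Pmx heis_a heis_z x *m heis_Lambda2 f x) k 0
    = frame k 0 x * heis_A2 f x - frame k 1 x * heis_A1 f x.
  rewrite mxE sum_mxtens_index sum_ord3.
  have P p q : Pmx heis_a heis_z x k (mxtens_index (p, q)) = (p == 2)%:R * frame k q x.
    by rewrite mxE mxtens_indexK -[(heis_z x)^T 0 p]/(center p x) centerE.
  rewrite [X in X + _ + _]big1 => [|q _]; last by rewrite P !mul0r.
  rewrite [X in _ + X + _]big1 => [|q _]; last by rewrite P !mul0r.
  rewrite sum_ord3 !P /= !mul1r !add0r.
  have L0 : heis_Lambda2 f x (mxtens_index (2, 0)) 0 = heis_A2 f x by rewrite !mxE.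
  have L1 : heis_Lambda2 f x (mxtens_index (2, 1)) 0 = - heis_A1 f x by rewrite !mxE.
  have L2 : heis_Lambda2 f x (mxtens_index (2, 2)) 0 = 0 by rewrite !mxE.
  by rewrite L0 L1 L2 mulr0 addr0 mulrN.
by rewrite sum_ord2 !E !frameE !(mul1r, mul0r) subr0 sub0r sqrrN addrC.
Qed.

Lemma RGab_heis V f x :
  RGab heis_a heis_z heis_Lambda1 (heis_Lambda2 f) V f x
  = Rab heis_a V f x - (heis_A1 f x ^+ 2 + heis_A2 f x ^+ 2)
    + 2^-1 * partial 2 f x ^+ 2.
Proof.
rewrite /RGab sqnorm_Dvec sqnorm_Evec sqnorm_P_Lambda2 addr0.
by rewrite /heis_Lambda1 mulmx0 mxE subr0.
Qed.

(** * Explicit formulas for the quadratic form, the drift and its derivatives *)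

Lemma quadratic_form_seqmx3 (u0 u1 u2 a00 a01 a02 a11 a12 a22 : R) :
  let u : 'cV[R]_3 := (seqmx 1 3 [:: [:: u0; u1; u2]])^T in
  (u^T *m seqmx 3 3 [:: [:: a00; a01; a02]; [:: a01; a11; a12]; [:: a02; a12; a22]]
    *m u) 0 0
  = a00 * u0 ^+ 2 + a11 * u1 ^+ 2 + a22 * u2 ^+ 2
    + 2 * (a01 * u0 * u1 + a02 * u0 * u2 + a12 * u1 * u2).
Proof. by rewrite /= mxE sum_ord3 !mxE !sum_ord3 !mxE /=; ring. Qed.

Lemma dhoriz0 p V x :
  dhoriz p 0 V x = partial p (partial 0 V) x - x 0 1 / 2 * partial p (partial 2 V) x
                   - (p == 1)%:R / 2 * partial 2 V x.
Proof.
rewrite /dhoriz sum_ord3 /dframe /= !frameE.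
move: (@partial R) => d.
move: (d p (d 0 V) x) (d p (d 1 V) x) (d p (d 2 V) x) (d 0 V x) (d 1 V x) (d 2 V x)
  ((p == 1)%:R : R) (x 0 1) => *.
ring.
Qed.

Lemma dhoriz1 p V x :
  dhoriz p 1 V x = partial p (partial 1 V) x + x 0 0 / 2 * partial p (partial 2 V) x
                   + (p == 0)%:R / 2 * partial 2 V x.
Proof.
rewrite /dhoriz sum_ord3 /dframe /= !frameE.
move: (@partial R) => d.
move: (d p (d 0 V) x) (d p (d 1 V) x) (d p (d 2 V) x) (d 0 V x) (d 1 V x) (d 2 V x)
  ((p == 0)%:R : R) (x 0 0) => *.
ring.
Qed.

Lemma partial_drift0 p V x : smooth V ->
  partial p (drift heis_a V 0) x = - 2^-1 * dhoriz p 0 V x.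
Proof.
move=> sV; rewrite partial_drift// sum_ord2 !frameE /dframe /=.
by rewrite !mul0r !add0r addr0 mul1r.
Qed.

Lemma partial_drift1 p V x : smooth V ->
  partial p (drift heis_a V 1) x = - 2^-1 * dhoriz p 1 V x.
Proof.
move=> sV; rewrite partial_drift// sum_ord2 !frameE /dframe /=.
by rewrite !mul0r !add0r mul1r.
Qed.

Lemma partial_drift2 p V x : smooth V ->
  partial p (drift heis_a V 2) x =
  - 2^-1 * ((p == 0)%:R / 2 * heis_A2 V x - (p == 1)%:R / 2 * heis_A1 V x
            + x 0 0 / 2 * dhoriz p 1 V x - x 0 1 / 2 * dhoriz p 0 V x).
Proof.
move=> sV; rewrite partial_drift// sum_ord2 !frameE /dframe /=.
rewrite -/(heis_A1 V x) -/(heis_A2 V x); congr (_ * _).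
move: (heis_A1 V x) (heis_A2 V x) (dhoriz _ _ _ _) (dhoriz _ _ _ _).
move: (x 0 0) (x 0 1) => *.
ring.
Qed.

Lemma drift0 V x : drift heis_a V 0 x = - 2^-1 * heis_A1 V x.
Proof. by rewrite driftE sum_ord2 !frameE mul0r addr0 mul1r. Qed.

Lemma drift1 V x : drift heis_a V 1 x = - 2^-1 * heis_A2 V x.
Proof. by rewrite driftE sum_ord2 !frameE mul0r add0r mul1r. Qed.

(** The only nonzero d_r alpha_iq have q = 3, with value -1/2 for (i, r) = (1, 2) and 1/2 for (i, r)
    = (2, 1); hence the opposite signs of the two undifferentiated drift terms. *)
Lemma Rab_heis V f x :
  let b r := drift heis_a V r in
  Rab heis_a V f x =
  - 2 * (\sum_r (partial 0 (b r) x - x 0 1 / 2 * partial 2 (b r) x) * partial r f x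
         + b 1 x / 2 * partial 2 f x) * heis_A1 f x
  - 2 * (\sum_r (partial 1 (b r) x + x 0 0 / 2 * partial 2 (b r) x) * partial r f x
         - b 0 x / 2 * partial 2 f x) * heis_A2 f x.
Proof.
pose S (a : 'I_3 -> R) (db d : 'I_3 -> 'I_3 -> R) (b df : 'I_3 -> R) :=
  \sum_q \sum_r (a q * db q r * df r - b r * d r q * df q).
pose db q r := partial q (drift heis_a V r) x.
pose b r := drift heis_a V r x.
pose df r := partial r f x.
have S0 : S (frame 0 ^~ x) db (fun r q => dframe r 0 q) b df
  = \sum_r (db 0 r - x 0 1 / 2 * db 2 r) * df r + b 1 / 2 * df 2.
  (* Generalizing forgets the bodies of [db], [b] and [df], so the expansion is an identity between
     opaque atoms. *)
  move: db b df => db b df.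
  rewrite /S !sum_ord3 /dframe /= !frameE.
  move: (x 0 1) => y.
  by ring.
have S1 : S (frame 1 ^~ x) db (fun r q => dframe r 1 q) b df
  = \sum_r (db 1 r + x 0 0 / 2 * db 2 r) * df r - b 0 / 2 * df 2.
  move: db b df {S0} => db b df.
  rewrite /S !sum_ord3 /dframe /= !frameE.
  move: (x 0 0) => y.
  by ring.
rewrite Rab_heis_sum sum_ord2 /=.
rewrite -[X in _ * (X * _ + _)]/(S (frame 0 ^~ x) db (fun r q => dframe r 0 q) b df).
rewrite -[X in _ * (_ + X * _)]/(S (frame 1 ^~ x) db (fun r q => dframe r 1 q) b df).
by rewrite S0 S1 mulrDr !mulrA !mulNr.
Qed.

End HeisenbergFrame.

(** * Assembly into the quadratic form in U *)

Theorem corollary4p2 (R : realType) (V : 'rV[R]_3 -> R) :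
  smooth V ->
  (partition_function V < +oo)%E ->
  forall f : 'rV[R]_3 -> R, smooth f ->
  forall x : 'rV[R]_3,
    RGab heis_a heis_z heis_Lambda1 (heis_Lambda2 f) V f x
    + Rzb heis_a heis_z V f x
    + Rrho heis_a heis_z V f x
    = ((heis_U f x)^T *m heis_mx V x *m heis_U f x) 0 0.
Proof.
move=> sV _ f _ x.
rewrite RGab_heis Rzb_heis Rrho_heis Rab_heis addr0.
rewrite quadratic_form_seqmx3 ZopE.
rewrite !sum_ord3 drift0 drift1 !partial_drift0// !partial_drift1// !partial_drift2//.
rewrite !dhoriz0 !dhoriz1 /=.
rewrite /heis_A1 /heis_A2 !AopE0 !AopE1.
have C p q := partialC _ V p q x sV.
(* With [partial] a variable, conversion no longer unfolds it to a limit when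
   matching distinct second derivatives. *)
move: (C 1 0) (C 2 0) (C 2 1); move: (@partial R) => d -> -> -> {C sV}.
move: (d 0 (d 0 V) x) (d 0 (d 1 V) x) (d 0 (d 2 V) x) => V00 V01 V02.
move: (d 1 (d 1 V) x) (d 1 (d 2 V) x) (d 2 (d 2 V) x) => V11 V12 V22.
move: (d 0 V x) (d 1 V x) (d 2 V x) => V0 V1 V2.
move: (d 0 f x) (d 1 f x) (d 2 f x) (x 0 0) (x 0 1) => f0 f1 f2 x1 x2.
(* The coefficient of A_1 f A_2 f is A_1 A_2 V + A_2 A_1 V, in which the first-order parts ZV/2 and
   -ZV/2 cancel. First derivatives of V survive only in A_13 and A_23, half coming from the
   undifferentiated drift and half from the derivatives of its vertical component. *)
by field.
Qed.
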